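(* Let $n$ be a positive integer that is not a power of $2$; write $n=2^{\nu_2(n)}m$ with $m$ odd, $m\ge3$, and set $b=\lfloor\frac{\nu_2(n)-1}{2}\rfloor$. Then: (1) if $\nu_2(n)=0$ (i.e. $n$ is odd), $\mathsf{D}_2(\mathbb{Z}_n)\le 2n-1$; (2) if $\nu_2(n)\ge1$ (i.e. $n$ is even), $\mathsf{D}_2(\mathbb{Z}_n)\le\big(2+\frac{1}{2^b}\big)n-1$.
   Context: $\nu_2(n)$ is the exponent of $2$ in $n$. A sequence over $\mathbb{Z}_n$ is a finite multiset of elements; its length counts multiplicity, and a subsequence is a sub-multiset. For $S=(a_1,\dots,a_\ell)$, $e_2(S)=\sum_{1\le i<j\le\ell}a_ia_j$. $\mathsf{D}_2(\mathbb{Z}_n)$ is the smallest positive integer $t$ such that every sequence $S$ over $\mathbb{Z}_n$ with $|S|\ge t$ contains a subsequence $S'$ with $|S'|\ge2$ and $e_2(S')=0$ in $\mathbb{Z}_n$. *)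

(* Defs.v *)
From HB Require Import structures.
From mathcomp Require Import all_boot all_order all_algebra.
From mathcomp Require Import boolp ring.
Set Implicit Arguments.
Unset Strict Implicit.
Unset Printing Implicit Defensive.
Import GRing.Theory.
Local Open Scope ring_scope.

(* A sequence (finite multiset) over R is represented by any list enumerating
   it, and a sub-multiset by an order-preserving sublist.  The order of the
   list is immaterial: see [e2_perm] and [has_zero_e2P]. *)
Definition e2 (R : comNzRingType) (S : seq R) : R :=
  \sum_(i < size S) \sum_(j < size S | (i < j)%N) S`_i * S`_j.

Definition has_zero_e2 (R : comNzRingType) (S : seq R) : Prop :=
  exists S' : seq R, [/\ subseq S' S, (2 <= size S')%N & e2 S' = 0].

Definition D2_bound (R : finComNzRingType) (t : nat) : Prop :=
  (0 < t)%N /\ forall S : seq R, (t <= size S)%N -> has_zero_e2 S.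

Lemma e2_cons (R : comNzRingType) (x : R) (S : seq R) :
  e2 (x :: S) = x * (\sum_(y <- S) y) + e2 S.
Proof.
rewrite /e2 /= big_ord_recl; congr (_ + _).
  rewrite big_mkcond big_ord_recl /= add0r (big_nth 0) big_mkord mulr_sumr.
  by apply: eq_bigr => j _.
apply: eq_bigr => i _.
by rewrite big_mkcond big_ord_recl /= add0r [RHS]big_mkcond.
Qed.

Lemma e2_cat (R : comNzRingType) (S T : seq R) :
  e2 (S ++ T) = e2 S + e2 T + (\sum_(x <- S) x) * (\sum_(y <- T) y).
Proof.
elim: S => [|x S IH] /=; first by rewrite /e2 /= !big_ord0 big_nil mul0r add0r addr0.
by rewrite !e2_cons IH big_cat big_cons /=; ring.
Qed.

Lemma e2_perm (R : comNzRingType) (S T : seq R) : perm_eq S T -> e2 S = e2 T.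
Proof.
move=> pST; pose P U := e2 U = e2 S.
suff: P T by move=> ->.
apply: (catCA_perm_ind _ pST); last by [].
move=> A B C; rewrite /P => <-.
by rewrite !e2_cat !big_cat /=; ring.
Qed.

Lemma has_zero_e2P (R : comNzRingType) (S : seq R) :
  has_zero_e2 S <->
  exists S' : seq R, [/\ forall x, (count_mem x S' <= count_mem x S)%N,
                        (2 <= size S')%N & e2 S' = 0].
Proof.
split=> [[S' [sS' h e]]|[S' [/count_subseqP [T sT pT] h e]]].
  by exists S'; split=> // x; apply: leq_count_subseq.
by exists T; split=> //; [rewrite -(perm_size pT)|rewrite -(e2_perm pT)].
Qed.

Lemma e2_nseq (R : comNzRingType) (x : R) (k : nat) :
  e2 (nseq k x) = x ^+ 2 *+ 'C(k, 2).
Proof.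
elim: k => [|k IH]; first by rewrite /e2 big_ord0.
rewrite [nseq _ _]/= e2_cons IH binS bin1 addnC mulrnDr big_nseq -Monoid.iteropE.
by rewrite [X in x * X](_ : _ = x *+ k) // mulrnAr -expr2 addrC.
Qed.

(* A list with more than 2 #|R|^2 terms contains some x at least
   2 #|R| times, and 'C(2 #|R|, 2) is a multiple of #|R|. *)
Lemma D2_bound_ex (R : finComNzRingType) : exists t, `[< D2_bound R t >].
Proof.
set n := #|R|.
have n0 (x : R) : x *+ n = 0.
  apply: (addIr (\sum_(y : R) y)); rewrite add0r.
  by rewrite [RHS](reindex_inj (addrI x)) /= big_split /= sumr_const.
exists (n * n.*2).+1; apply/asboolP; split=> // S hS.
have [x hx] : exists x, (n.*2 <= count_mem x S)%N.
  apply/existsP; apply: contraLR hS; rewrite negb_exists => /forallP h.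
  rewrite -leqNgt -sum1_size (partition_big id xpredT) //=.
  rewrite /n -sum_nat_const; apply: leq_sum => x _; rewrite sum1_count.
  by apply: ltnW; rewrite ltnNge; exact: h.
apply/has_zero_e2P; exists (nseq n.*2 x); split.
- move=> y; rewrite count_nseq /=; case: eqP => [<-|_] //; by rewrite mul1n.
- by rewrite size_nseq (leq_double 1); apply/card_gt0P; exists 0.
- by rewrite e2_nseq bin2 -doubleMl doubleK mulrnA n0 mul0rn.
Qed.

(* The least t with [D2_bound R t].  For R := 'Z_n this is D_2(Z/nZ) only when
   1 < n, since 'Z_0 and 'Z_1 are Z/2Z. *)
Definition D2 (R : finComNzRingType) : nat := ex_minn (D2_bound_ex R).

(* Main.v *)
(* Up to a factor 2, e_2 of a sequence is the square of its sum minus the sum of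
   its squares, so it suffices to find a subsequence that is a zero sum in a
   group of rank 2, and the bounds come from D(Z_a + Z_b) <= a + b - 1 for a | b
   (Olson).  The latter reduces to elementary p-groups F_p^d.  There, if a
   sequence longer than d (p - 1) had no nonempty zero sum, then the function
   prod_j (1 - x_j ^ (p - 1)), of degree d (p - 1), would vanish at all nonempty
   subsums but not at 0, although the alternating sum of its values over all
   subsums is an iterated difference, hence 0. *)
Require Import Defs.
From HB Require Import structures.
From mathcomp Require Import all_boot all_order all_algebra all_field.
From mathcomp Require Import boolp zify ring.
Set Implicit Arguments.
Unset Strict Implicit.
Unset Printing Implicit Defensive.
Import Order.TTheory GRing.Theory Num.Theory.
Local Open Scope ring_scope.

(** * Polynomial functions through finite differences *)

Section FiniteDifferences.
Variables (G : zmodType) (K : comNzRingType).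
Implicit Types (F H : G -> K) (g x : G).

Definition fdiff g F x : K := F x - F (x + g).

(* deglt n F: F is a polynomial function of degree < n. *)
Fixpoint deglt (n : nat) F : Prop :=
  if n is n'.+1 then forall g, deglt n' (fdiff g F) else F =1 (fun=> 0).

Lemma eq_deglt n F H : F =1 H -> deglt n F -> deglt n H.
Proof.
elim: n F H => [|n IH] F H eqFH /= dF; first by move=> x; rewrite -eqFH dF.
by move=> g; apply: IH (dF g) => x; rewrite /fdiff !eqFH.
Qed.

Lemma deglt0 n : deglt n (fun=> 0).
Proof.
elim: n => [//|n IH] g /=.
by apply: eq_deglt IH => x; rewrite /fdiff subrr.
Qed.

Lemma deglt_const n c : deglt n.+1 (fun=> c).
Proof. by move=> g; apply: eq_deglt (deglt0 n) => x; rewrite /fdiff subrr. Qed.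

Lemma degltD n F H : deglt n F -> deglt n H -> deglt n (fun x => F x + H x).
Proof.
elim: n F H => [|n IH] F H dF dH; first by move=> x; rewrite dF dH addr0.
move=> g; apply: eq_deglt (IH _ _ (dF g) (dH g)) => x.
by rewrite /fdiff; ring.
Qed.

Lemma degltN n F : deglt n F -> deglt n (fun x => - F x).
Proof.
elim: n F => [|n IH] F dF; first by move=> x; rewrite dF oppr0.
move=> g; apply: eq_deglt (IH _ (dF g)) => x.
by rewrite /fdiff; ring.
Qed.

Lemma deglt_shift n g F : deglt n F -> deglt n (fun x => F (x + g)).
Proof.
elim: n F => [|n IH] F dF; first by move=> x; rewrite dF.
move=> g'; apply: eq_deglt (IH _ (dF g')) => x.
by rewrite /fdiff addrAC.
Qed.

(** Leibniz rule: the difference of F H along g is F times the difference of H, plus the difference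
    of F times a shift of H. Each summand loses one degree, so induction on m + n applies. *)
Lemma degltM m n F H :
  deglt m.+1 F -> deglt n.+1 H -> deglt (m + n).+1 (fun x => F x * H x).
Proof.
move: {2}(m + n)%N (erefl (m + n)%N) => k.
elim: k m n F H => [|k IH] m n F H Ek dF dH g; rewrite Ek.
  have [m0 n0] : m = 0%N /\ n = 0%N by lia.
  move=> x; move: (dF g) (dH g); rewrite m0 n0 /= => eF eH.
  rewrite /fdiff (_ : _ - _ = fdiff g F x * H x + F (x + g) * fdiff g H x).
    by rewrite eF eH mul0r mulr0 addr0.
  by rewrite /fdiff; ring.
have -> : fdiff g (fun x => F x * H x)
    = (fun x => F x * fdiff g H x + fdiff g F x * H (x + g)).
  by apply: funext => x; rewrite /fdiff; ring.
apply: (@degltD k.+1).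
  case: n => [|n] in Ek dH *.
    by apply: eq_deglt (deglt0 _) => x; rewrite (dH g) mulr0.
  have E : (m + n)%N = k by lia.
  rewrite -E; exact: IH E dF (dH g).
(* In degree 0 no degree is left to lose, but the difference itself is zero. *)
case: m => [|m] in Ek dF *.
  by apply: eq_deglt (deglt0 _) => x; rewrite (dF g) mul0r.
have E : (m + n)%N = k by lia.
rewrite -E; exact: IH E (dF g) (deglt_shift g dH).
Qed.

Lemma degltX m k F : deglt m.+1 F -> deglt (k * m).+1 (fun x => F x ^+ k).
Proof.
move=> dF; elim: k => [|k IH]; first exact: deglt_const.
rewrite mulSn; apply: eq_deglt (degltM dF IH) => x.
by rewrite exprS.
Qed.

Lemma deglt_prod m d (F : 'I_d -> G -> K) :
  (forall j, deglt m.+1 (F j)) -> deglt (d * m).+1 (fun x => \prod_j F j x).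
Proof.
elim: d F => [|d IH] F dF.
  by apply: eq_deglt (deglt_const _ 1) => x; rewrite big_ord0.
rewrite mulSn; apply: eq_deglt (degltM (dF ord0) (IH _ (fun j => dF (lift ord0 j)))).
by move=> x; rewrite big_ord_recl.
Qed.

(* The iterated difference along s is the alternating sum of F over all the
   sub-sums of s, only one of which survives. *)
Lemma deglt_vanish (s : seq G) F x : deglt (size s) F ->
  (forall t, subseq t s -> t != [::] -> F (x + \sum_(g <- t) g) = 0) -> F x = 0.
Proof.
elim: s F => [|g s IH] F dF F0; first exact: dF.
have Fg : F (x + g) = 0.
  rewrite -(F0 [:: g]) ?big_seq1 //= eqxx; exact: sub0seq.
have -> : F x = fdiff g F x by rewrite /fdiff Fg subr0.
apply: (IH (fdiff g F)) => [|t ts t0]; first exact: dF.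
rewrite /fdiff F0 //; last exact: subseq_trans ts (subseq_cons _ _).
have -> : x + \sum_(h <- t) h + g = x + \sum_(h <- g :: t) h.
  by rewrite big_cons addrAC addrA.
by rewrite F0 ?subrr //= eqxx.
Qed.

End FiniteDifferences.

(** * Zero sums in elementary p-groups *)

Lemma Fp_fermat p (x : 'F_p) : prime p -> x != 0 -> x ^+ p.-1 = 1.
Proof.
move=> p_pr x0; apply: (mulfI x0).
by rewrite -exprS prednK ?prime_gt0 // mulr1 -{2}(expf_card x) card_Fp.
Qed.

Lemma olson_seq p d (s : seq 'rV['F_p]_d) : prime p -> (d * p.-1 < size s)%N ->
  exists2 t, subseq t s & t != [::] /\ \sum_(v <- t) v = 0.
Proof.
move=> p_pr hs; apply: contrapT => no_t.
pose F (x : 'rV['F_p]_d) := \prod_(j < d) (1 - x 0 j ^+ p.-1).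
have F0 x : x != 0 -> F x = 0.
  move=> /rV0Pn [j xj]; rewrite /F (bigD1 j) //=.
  by rewrite Fp_fermat // subrr mul0r.
suff : F 0 = 0.
  move/eqP; rewrite /F big1 ?oner_eq0 // => j _.
  by rewrite mxE expr0n eqn0Ngt -subn1 subn_gt0 prime_gt1 //= subr0.
(* [deglt_vanish] wants the degree bound to be the length of the list, so s is cut to d (p - 1) + 1
   terms. *)
pose s' := take (d * p.-1).+1 s.
apply: (@deglt_vanish _ _ s') => [|t ts t0].
  rewrite size_takel //; apply: deglt_prod => j.
  apply: degltD; first exact: deglt_const.
  apply: degltN; rewrite -[X in deglt X.+1]muln1; apply: degltX.
  (* A coordinate is additive, so its second differences vanish. *)
  by move=> g g' x; rewrite /fdiff !mxE; ring.
rewrite add0r; apply: F0; apply/eqP => t_0; apply: no_t; exists t => //.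
exact: subseq_trans ts (take_subseq _ _).
Qed.

Lemma olson p d (I : finType) (A : {set I}) (f : I -> 'I_d -> nat) :
  prime p -> (d * p.-1 < #|A|)%N ->
  exists B : {set I}, [/\ B \subset A, B != set0
    & forall j, (p %| \sum_(i in B) f i j)%N].
Proof.
move=> p_pr hA; pose g i : 'rV['F_p]_d := \row_j (f i j)%:R.
have [|_ /subseqP [m _ ->] [t0 sum0]] := @olson_seq p d (map g (enum A)) p_pr.
  by rewrite size_map -cardE.
rewrite -map_mask in t0 sum0.
set s := mask m (enum A) in t0 sum0.
have us : uniq s by rewrite mask_uniq ?enum_uniq.
exists [set i in s]; split.
- apply/subsetP => i; rewrite inE => /mem_mask; by rewrite mem_enum.
- case: s t0 us {sum0} => [|i s] // _ _.
  by apply/set0Pn; exists i; rewrite inE mem_head.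
- move=> j; rewrite (dvdn_pcharf (pchar_Fp p_pr)) natr_sum.
  move/rowP/(_ j): sum0; rewrite big_map summxE mxE => /eqP.
  rewrite big_uniq //= => /eqP sum0; apply/eqP; rewrite -[RHS]sum0.
  by apply: eq_big => [i|i _]; rewrite ?inE ?mxE.
Qed.

(** * Zero sums in groups of rank two *)

Definition zero_sum (I : finType) (f1 f2 : I -> nat) (a b : nat) (B : {set I}) :=
  (a %| \sum_(i in B) f1 i)%N && (b %| \sum_(i in B) f2 i)%N.

(** This is D(Z_a + Z_b) <= a + b - 1. Natural numbers stand for residues so that sums can be
    divided by p; index sets keep equal terms apart. *)
Definition davenport_le (a b : nat) := forall (I : finType) (f1 f2 : I -> nat)
    (A : {set I}), (a + b <= #|A|.+1)%N ->
  exists B : {set I}, [/\ B \subset A, B != set0 & zero_sum f1 f2 a b B].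

Lemma olson1 p (I : finType) (A : {set I}) (f : I -> nat) :
  prime p -> (p <= #|A|)%N ->
  exists B : {set I}, [/\ B \subset A, B != set0 & (p %| \sum_(i in B) f i)%N].
Proof.
move=> p_pr hA.
have [|B [sBA B0 dB]] := @olson p 1 I A (fun i _ => f i) p_pr.
  by rewrite mul1n prednK ?prime_gt0.
by exists B; split=> //; exact: (dB ord0).
Qed.

Lemma olson2 p : prime p -> davenport_le p p.
Proof.
move=> p_pr I f1 f2 A hA.
have [|B [sBA B0 dB]] :=
  @olson p 2 I A (fun i j => if j == 0%N :> nat then f1 i else f2 i) p_pr.
  by move: (prime_gt0 p_pr); lia.
exists B; split=> //.
by rewrite /zero_sum (dB (@Ordinal 2 0 isT)) (dB (@Ordinal 2 1 isT)).
Qed.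

(** A third coordinate, constantly 1, controls the length of the zero sum. *)
Lemma olson3 p (I : finType) (A : {set I}) (f1 f2 : I -> nat) :
  prime p -> (3 * p - 2 <= #|A|)%N ->
  exists B : {set I}, [/\ B \subset A, B != set0, (p %| #|B|)%N
    & zero_sum f1 f2 p p B].
Proof.
move=> p_pr hA.
have [|B [sBA B0 dB]] := @olson p 3 I A
  (fun i j => if j == 0%N :> nat then f1 i else
              if j == 1%N :> nat then f2 i else 1%N) p_pr.
  by move: (prime_gt0 p_pr); lia.
exists B; split=> //.
  by move: (dB (@Ordinal 3 2 isT)); rewrite /= sum1_card.
by rewrite /zero_sum (dB (@Ordinal 3 0 isT)) (dB (@Ordinal 3 1 isT)).
Qed.

Lemma zero_sumD (I : finType) (f1 f2 : I -> nat) a b (B C : {set I}) :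
  B \subset C -> zero_sum f1 f2 a b C -> zero_sum f1 f2 a b B ->
  zero_sum f1 f2 a b (C :\: B).
Proof.
move=> /setIidPr sBC; rewrite /zero_sum.
rewrite !(big_setID B (A := C)) /= sBC => /andP [d1 d2] /andP [e1 e2].
by rewrite dvdn_addr // in d1; rewrite dvdn_addr // in d2; rewrite d1.
Qed.

(* A zero sum of length 2 p, cut along a zero sum among 2 p - 1 of its terms,
   leaves one of length at most p. *)
Lemma short_zero_sum p (I : finType) (A : {set I}) (f1 f2 : I -> nat) :
  prime p -> (3 * p - 2 <= #|A|)%N ->
  exists B : {set I}, [/\ B \subset A, B != set0, (#|B| <= p)%N
    & zero_sum f1 f2 p p B].
Proof.
move=> p_pr hA; have p1 := prime_gt1 p_pr.
(* With exactly 3 p - 2 terms, the length found below can only be p or 2 p. *)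
have [s [us ss sA]] := card_geqP hA.
have cs : #|[set i in s]| = (3 * p - 2)%N.
  by rewrite cardsE -ss; apply/card_uniqP.
have [|C [sC C0 /dvdnP [k kC] zC]] := @olson3 p I [set i in s] f1 f2 p_pr.
  by rewrite cs.
have sCA : C \subset A.
  apply: subset_trans sC _; apply/subsetP => i; rewrite inE; exact: sA.
have lek : (k <= 2)%N.
  have := subset_leq_card sC; rewrite cs kC => h.
  by have : (k * p < 3 * p)%N; [lia | rewrite ltn_mul2r => /andP []].
have [leC|ltC] := leqP #|C| p; first by exists C.
have C2 : #|C| = (2 * p)%N by rewrite kC in ltC *; congr (_ * _)%N; nia.
(* Removing x leaves the 2 p - 1 terms needed for [olson2], and x keeps [C :\: B] nonempty. *)
case/set0Pn: C0 => x xC.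
have [|B [sB B0 zB]] := @olson2 p p_pr I f1 f2 (C :\ x).
  by move: (cardsD1 x C); rewrite xC C2; lia.
have [sBC xB] : B \subset C /\ x \notin B by move: sB; rewrite subsetD1 => /andP.
have [leB|ltB] := leqP #|B| p.
  by exists B; split=> //; exact: subset_trans sBC sCA.
exists (C :\: B); split.
- exact: subset_trans (subsetDl _ _) sCA.
- by apply/set0Pn; exists x; rewrite inE xB.
- by rewrite cardsD (setIidPr sBC) C2; lia.
- exact: zero_sumD.
Qed.

(** * Disjoint families of zero sums and descent to quotients *)

Definition packing (I : finType) (A : {set I}) (Q : {set I} -> bool)
    (P : {set {set I}}) :=
  [/\ trivIset P, set0 \notin P, cover P \subset A & {in P, forall B, Q B}].

Lemma packingU1 (I : finType) (A B : {set I}) Q P :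
  packing A Q P -> B \subset A :\: cover P -> B != set0 -> Q B ->
  [/\ packing A Q (B |: P), #|B |: P| = #|P|.+1
    & cover (B |: P) = B :|: cover P].
Proof.
move=> [tP P0 sP QP]; rewrite subsetD => /andP [sBA dB] B0 QB.
have coverU : cover (B |: P) = B :|: cover P.
  by rewrite /cover bigcup_setU big_set1.
have [|tBP BP] := @trivIsetU1 _ B P _ tP P0.
  by move=> C CP; apply: disjointWr dB; exact: bigcup_sup.
split=> //; last by rewrite cardsU1 BP.
split=> //.
- by rewrite !inE negb_or eq_sym B0.
- by rewrite coverU subUset sBA.
- by move=> C; rewrite !inE => /predU1P [-> //|]; exact: QP.
Qed.

(** Greedy extraction: each block uses at most p terms, so at least p + r remain before every one of
    the k choices. *)
Lemma packing_exists (I : finType) (A : {set I}) (Q : {set I} -> bool) p r k :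
  (forall A' : {set I}, (p + r <= #|A'|)%N ->
     exists B : {set I}, [/\ B \subset A', B != set0, (#|B| <= p)%N & Q B]) ->
  (k * p + r <= #|A|)%N ->
  exists P, [/\ packing A Q P, #|P| = k & (#|cover P| <= k * p)%N].
Proof.
move=> short; elim: k => [|k IH] hA.
  exists set0; split; rewrite ?cards0 //; last by rewrite /cover big_set0 cards0.
  split; rewrite ?inE //; last by move=> B; rewrite inE.
  - by apply/trivIsetP => B C; rewrite inE.
  - by rewrite /cover big_set0 sub0set.
have [|P [packP cP covP]] := IH; first by move: hA; rewrite mulSn; lia.
have [|B [sB B0 leB QB]] := short (A :\: cover P).
  have [_ _ sP _] := packP.
  by rewrite cardsD (setIidPr sP); move: hA; rewrite mulSn; lia.
have [packBP cBP covBP] := packingU1 packP sB B0 QB.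
exists (B |: P); split; rewrite ?cBP ?cP // covBP mulSn.
by rewrite (leq_trans (leq_card_setU _ _)) // leq_add.
Qed.

(** The blocks, with their sums divided by q and p, become the terms of a new sequence; the union of
    a zero-sum subfamily is the required zero sum. *)
Lemma davenport_step (I : finType) (f1 f2 : I -> nat) (A : {set I}) q p a b P :
  packing A (zero_sum f1 f2 q p) P -> davenport_le a b ->
  (a + b <= #|P|.+1)%N ->
  exists B : {set I}, [/\ B \subset A, B != set0
    & zero_sum f1 f2 (q * a) (p * b) B].
Proof.
move=> [tP P0 sP zP] dav hP.
have [J [sJ J0 /andP [z1 z2]]] := dav _
  (fun B : {set I} => (\sum_(i in B) f1 i) %/ q)%N
  (fun B : {set I} => (\sum_(i in B) f2 i) %/ p)%N P hP.
have zJ B : B \in J -> zero_sum f1 f2 q p B by move/(subsetP sJ)/zP.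
have tJ := trivIsetS sJ tP.
exists (cover J); split.
- apply: subset_trans sP; apply/bigcupsP => B BJ.
  by apply: bigcup_sup; exact: (subsetP sJ).
- case/set0Pn: J0 => B BJ.
  have : B != set0 by apply: contraNneq P0 => <-; exact: (subsetP sJ).
  case/set0Pn => i iB; apply/set0Pn; exists i.
  by apply/bigcupP; exists B.
- rewrite /zero_sum !big_trivIset //=.
  have -> : (\sum_(B in J) \sum_(i in B) f1 i
      = q * \sum_(B in J) ((\sum_(i in B) f1 i) %/ q))%N.
    rewrite big_distrr /=; apply: eq_bigr => B /zJ /andP [d _].
    by rewrite mulnC divnK.
  have -> : (\sum_(B in J) \sum_(i in B) f2 i
      = p * \sum_(B in J) ((\sum_(i in B) f2 i) %/ p))%N.
    rewrite big_distrr /=; apply: eq_bigr => B /zJ /andP [_ d].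
    by rewrite mulnC divnK.
  by rewrite !dvdn_mul.
Qed.

(* For p a prime factor of a, as many disjoint short zero sums modulo p as
   possible are extracted first; their sums divided by p are then treated
   modulo a / p and b / p. *)
Lemma davenport a b : (0 < b)%N -> (a %| b)%N -> davenport_le a b.
Proof.
elim/ltn_ind: b a => b IH a b0 ab I f1 f2 A hA.
have a0 : (0 < a)%N := dvdn_gt0 b0 ab.
have [a1|a_gt1] := leqP a 1.
  have {a1 ab a0} a1 : a = 1%N by lia.
  rewrite a1 in hA *.
  have [b1|b_gt1] := leqP b 1.
    have {}b1 : b = 1%N by lia.
    exists A; split=> //; last by rewrite /zero_sum b1 !dvd1n.
    by rewrite -card_gt0; lia.
  have p_pr := pdiv_prime b_gt1; set p := pdiv b in p_pr.
  have pb : (p * (b %/ p) = b)%N by rewrite mulnC divnK // pdiv_dvd.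
  have p1 := prime_gt1 p_pr.
  (* In the cyclic case any p terms contain a zero sum modulo p, so b terms yield b / p blocks. *)
  have [||P [packP cP _]] := @packing_exists I A (zero_sum f1 f2 1 p) p 0 (b %/ p).
  - move=> A'; rewrite addn0 => hA'.
    have [s [us ss sA']] := card_geqP hA'.
    have cs : #|[set i in s]| = p by rewrite cardsE -ss; apply/card_uniqP.
    have [|B [sB B0 dB]] := @olson1 p I [set i in s] f2 p_pr; first by rewrite cs.
    exists B; split=> //.
    - apply: subset_trans sB _; apply/subsetP => i; rewrite inE; exact: sA'.
    - by rewrite -cs subset_leq_card.
    - by rewrite /zero_sum dvd1n.
  - by rewrite addn0 mulnC pb; lia.
  have [||B] := @davenport_step I f1 f2 A 1 p 1 (b %/ p) P packP.
  - apply: IH; [exact: ltn_Pdiv | | exact: dvd1n].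
    by rewrite divn_gt0 ?prime_gt0 //; exact: pdiv_leq.
  - by rewrite cP; lia.
  by rewrite pb => hB; exists B.
have p_pr := pdiv_prime a_gt1; set p := pdiv a in p_pr.
have p1 := prime_gt1 p_pr.
have pa : (p %| a)%N := pdiv_dvd a.
have Ea : (p * (a %/ p) = a)%N by rewrite mulnC divnK.
have Eb : (p * (b %/ p) = b)%N by rewrite mulnC divnK // (dvdn_trans pa).
have a'0 : (0 < a %/ p)%N by rewrite divn_gt0 ?prime_gt0 // dvdn_leq.
have b'0 : (0 < b %/ p)%N.
  by rewrite divn_gt0 ?prime_gt0 // dvdn_leq // (dvdn_trans pa).
(* These blocks cover at most a + b - 2 p terms. The 2 p - 1 left over give one more block by
   [olson2], of any length, for a total of a / p + b / p - 1. *)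
have [||P [packP cP covP]] :=
    @packing_exists I A (zero_sum f1 f2 p p) p (2 * p - 2) (a %/ p + b %/ p - 2).
- move=> A' hA'; apply: short_zero_sum => //; apply: leq_trans hA'; lia.
- by move: hA; rewrite -{1}Ea -{1}Eb; nia.
have [|B [sB B0 zB]] := @olson2 p p_pr I f1 f2 (A :\: cover P).
  have [_ _ sP _] := packP.
  rewrite cardsD (setIidPr sP); move: hA covP; rewrite -{1}Ea -{1}Eb; nia.
have [packBP cBP _] := packingU1 packP sB B0 zB.
have [||D] := @davenport_step I f1 f2 A p p (a %/ p) (b %/ p) (B |: P) packBP.
- apply: IH; rewrite ?ltn_Pdiv //.
  by rewrite dvdn_divRL ?(dvdn_trans pa) // mulnC Ea.
- by rewrite cBP cP; lia.
by rewrite Ea Eb => hD; exists D.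
Qed.

(** * From zero sums to the vanishing of e_2 *)

Lemma e2_map (R R' : comNzRingType) (f : {rmorphism R -> R'}) (S : seq R) :
  e2 (map f S) = f (e2 S).
Proof.
elim: S => [|x S IH] /=; first by rewrite /e2 /= !big_ord0 rmorph0.
rewrite !e2_cons IH rmorphD rmorphM big_map; congr (_ * _ + _).
by rewrite rmorph_sum.
Qed.

Lemma e2_sqr (R : comNzRingType) (S : seq R) :
  e2 S * 2 = (\sum_(x <- S) x) ^+ 2 - \sum_(x <- S) x ^+ 2.
Proof.
elim: S => [|x S IH]; first by rewrite /e2 /= big_ord0 !big_nil; ring.
by rewrite e2_cons !big_cons mulrDl IH; ring.
Qed.

Section ZeroE2.
Variables (n : nat) (n1 : (1 < n)%N) (S : seq 'Z_n).
Implicit Types B : {set 'I_(size S)}.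

Let x (i : 'I_(size S)) : nat := nth 0 S i.
(** Lifting e_2 to the integers allows the factor 2 of [e2_sqr] to be cancelled even when 2 is a
    zero divisor modulo n. *)
Let E B : int := e2 [seq (x i)%:Z | i <- enum B].

Let E_sqr B :
  E B * 2 = ((\sum_(i in B) x i) ^ 2)%N%:Z - (\sum_(i in B) x i ^ 2)%N%:Z.
Proof.
rewrite /E e2_sqr !big_map !big_enum /=.
have sumZ f : (\sum_(i in B) f i)%N%:Z = \sum_(i in B) (f i)%:Z.
  exact: (big_morph Posz PoszD).
by rewrite -mulnn PoszM !sumZ expr2.
Qed.

Let has_zero_e2_sub B : (1 < #|B|)%N -> (n %| E B)%Z -> has_zero_e2 S.
Proof.
move=> B2 /dvdzP [q EB]; exists [seq S`_i | i : 'I_(size S) <- enum B]; split.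
- rewrite -[X in subseq _ X](mkseq_nth 0) /mkseq -val_enum_ord -map_comp.
  by apply: map_subseq; rewrite enumT; exact: filter_subseq.
- by rewrite size_map -cardE.
- have -> : [seq S`_i | i : 'I_(size S) <- enum B]
      = [seq z%:~R | z <- [seq (x i)%:Z | i <- enum B]].
    by rewrite -map_comp; apply: eq_map => i /=; rewrite /x -pmulrn natr_Zp.
  rewrite e2_map -/(E B) EB rmorphM /= -pmulrn pchar_Zp //.
  by rewrite mulr0.
Qed.

Lemma has_zero_e2_pair (i j : 'I_(size S)) :
  i != j -> (n %| x i * x j)%N -> has_zero_e2 S.
Proof.
move=> ij dn; apply: (@has_zero_e2_sub [set i; j]); first by rewrite cards2 ij.
suff -> : E [set i; j] = (x i * x j)%N by [].
apply: (@mulIf _ 2%:Z) => //; rewrite E_sqr !big_setU1 ?inE //= !big_set1.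
by rewrite -!mulnn !(PoszM, PoszD); ring.
Qed.

Lemma has_zero_e2_odd B : odd n -> (1 < #|B|)%N ->
  zero_sum x (fun i => x i ^ 2)%N n n B -> has_zero_e2 S.
Proof.
move=> n_odd B2 /andP [d1 d2]; apply: (has_zero_e2_sub B2).
rewrite -(@Gauss_dvdzl n (E B) 2); last by rewrite coprimezE coprimen2.
by rewrite E_sqr rpredB //; exact: dvdn_mulr.
Qed.

Lemma has_zero_e2_even B : (1 < #|B|)%N -> (2 * n %| (\sum_(i in B) x i) ^ 2)%N ->
  (2 * n %| \sum_(i in B) x i ^ 2)%N -> has_zero_e2 S.
Proof.
move=> B2 d1 d2; apply: (has_zero_e2_sub B2).
rewrite -(@dvdz_mul2r 2) // E_sqr -PoszM mulnC.
by rewrite rpredB.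
Qed.

End ZeroE2.

(** * The bounds for odd and even n *)

Lemma D2_bound_odd n : (1 < n)%N -> odd n -> D2_bound 'Z_n (2 * n - 1).
Proof.
move=> n1 n_odd; split=> [|S hS]; first by lia.
pose x (i : 'I_(size S)) : nat := nth 0 S i.
(* A term divisible by n can be paired with any other; without such a term, no single term is a zero
   sum. *)
have [i xi|nox] := pickP (fun i : 'I_(size S) => (n %| x i)%N).
  have [j ij] : exists j, i != j.
    have : (1 < #|'I_(size S)|)%N by rewrite card_ord; lia.
    move=> /card_gt1P [a [b [_ _ ab]]].
    by have [->|ia] := eqVneq i a; [exists b | exists a].
  by apply: (has_zero_e2_pair n1 ij); exact: dvdn_mulr.
have [|||B [_ B0 zB]] :=
  @davenport n n _ _ _ x (fun i => x i ^ 2)%N [set: 'I_(size S)].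
- by lia.
- exact: dvdnn.
- by rewrite cardsT card_ord; lia.
apply: (has_zero_e2_odd n1 n_odd _ zB).
rewrite ltnNge; apply/negP => B1.
have /cards1P [i Bi] : #|B| == 1%N by rewrite eqn_leq B1 card_gt0.
by move: zB; rewrite /zero_sum Bi !big_set1 nox.
Qed.

Lemma sqr_bin2 k : (k ^ 2 = 2 * 'C(k, 2) + k)%N.
Proof. by elim: k => [|k IH] //; rewrite binS bin1; nia. Qed.

(* x |-> (C(x, 2) mod h, x ^ 2 mod 2 n) makes a zero sum kill the sum of the
   squares mod 2 n and, since x = x ^ 2 - 2 C(x, 2), the sum mod 2 h.  It needs
   h fewer terms than working with (x mod 2 h, x ^ 2 mod 2 n), and this leaves
   room to discard the at most one term that is a zero sum by itself. *)
Lemma D2_bound_even n h : (0 < h)%N -> (2 * h %| n)%N ->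
  (2 * n %| (2 * h) ^ 2)%N -> (1 < n)%N -> D2_bound 'Z_n (2 * n + 2 * h - 1).
Proof.
move=> h0 hn nh n1; split=> [|S hS]; first by lia.
pose x (i : 'I_(size S)) : nat := nth 0 S i.
pose bad := [set i | (2 * h %| x i)%N].
(* The product of two multiples of 2 h is divisible by (2 h)^2, hence by 2 n. *)
have [bad1|] := leqP #|bad| 1; last first.
  move=> /card_gt1P [i [j [bi bj ij]]]; rewrite !inE in bi bj.
  apply: (has_zero_e2_pair n1 ij); apply: (@dvdn_trans (2 * n)).
    exact: dvdn_mull.
  by apply: (dvdn_trans nh); exact: dvdn_mul.
have hn2 : (2 * h %| 2 * n)%N by apply: dvdn_mull.
have [|||B [sB B0 /andP [d1 d2]]] :=
  @davenport h (2 * n) _ _ _ (fun i => 'C(x i, 2)) (fun i => x i ^ 2)%N (~: bad).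
- by lia.
- by apply: dvdn_trans hn2; exact: dvdn_mull.
- by have := cardsC bad; rewrite card_ord; lia.
have dx : (2 * h %| \sum_(i in B) x i)%N.
  have : (2 * h %| \sum_(i in B) x i ^ 2)%N := dvdn_trans hn2 d2.
  under eq_bigr do rewrite sqr_bin2.
  by rewrite big_split -big_distrr /= dvdn_addr // dvdn_pmul2l.
have dx2 : (2 * n %| (\sum_(i in B) x i) ^ 2)%N.
  by apply: (dvdn_trans nh); exact: dvdn_exp2r.
apply: (has_zero_e2_even n1 _ dx2 d2).
rewrite ltnNge; apply/negP => B1.
have /cards1P [i Bi] : #|B| == 1%N by rewrite eqn_leq B1 card_gt0.
by move: sB dx; rewrite Bi sub1set !inE big_set1 => /negP.
Qed.

Lemma D2_le (R : finComNzRingType) t : D2_bound R t -> (D2 R <= t)%N.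
Proof. by move=> /asboolP Rt; rewrite /D2; case: ex_minnP => m _; apply. Qed.

Theorem theorem18 (n : nat) (hn : (0 < n)%N)
    (hpow : forall k : nat, n <> (2 ^ k)%N) :
  (logn 2 n = 0%N -> (D2 'Z_n <= 2 * n - 1)%N) /\
  ((1 <= logn 2 n)%N ->
     let b := ((logn 2 n - 1) %/ 2)%N in
     (D2 'Z_n)%:R <= (2 + 1 / 2 ^+ b) * n%:R - 1 :> rat).
Proof.
(* The exponent 0 excludes n = 1, where ['Z_n] would have two elements. *)
have n1 : (1 < n)%N by move: (hpow 0%N); lia.
split=> [ln0|ln1 /=].
  apply/D2_le/D2_bound_odd => //.
  rewrite -[odd n]negbK -dvdn2; apply/negP => d2.
  by move: (ln0) => /eqP; rewrite -leqn0 leqNgt -pfactor_dvdn // expn1 d2.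
set b := ((logn 2 n - 1) %/ 2)%N.
have b_le : (b.*2.+1 <= logn 2 n)%N by rewrite /b; lia.
have /dvdnP [g ng] : (2 ^ b.*2.+1 %| n)%N by rewrite pfactor_dvdn.
(* The choice h = n / 2^(b + 1) gives 2 h = n / 2^b, the extra term of the bound; 2 n divides (2
   h)^2 because 2^(2 b + 1) divides n. *)
have [h nh sq] :
    exists2 h, n = (2 * (2 ^ b * h))%N & ((2 * h) ^ 2 = 2 * n * g)%N.
  by exists (2 ^ b * g)%N; rewrite -?mulnn ng expnS -addnn expnD; ring.
have h0 : (0 < h)%N.
  by rewrite lt0n; apply: contraTneq hn => h0; rewrite nh h0 !muln0.
have /D2_le D2n : D2_bound 'Z_n (2 * n + 2 * h - 1).
  apply: D2_bound_even => //; last by rewrite sq dvdn_mulr.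
  by rewrite nh dvdn_pmul2l // dvdn_mull.
apply: (@le_trans _ _ (2 * n + 2 * h - 1)%N%:R); first by rewrite ler_nat.
rewrite natrB; last by lia.
rewrite (natrD _ (2 * n) (2 * h)) lerD2r mulrDl !(natrM _ 2) lerD2l.
by rewrite [in n%:R]nh !natrM natrX div1r mulrCA mulKf // expf_neq0.
Qed.
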